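(* Let $X_1=X_2=\mathbb R^d$, let $\mu_1=\mu_2$ be the uniform distribution on $[0,1]^d$, and let $c(x,y)=\sum_{i=1}^d|x_i-y_i|$. Then for $q>1$ and every $\varepsilon>0$, $$\mathrm{OT}_{q,\varepsilon}-\mathrm{OT}\ge\tilde K_{1,q}\,\varepsilon^{\frac{1}{(q-1)d+1}}-\tilde K_{2,q}\,\varepsilon,$$ where $$\tilde K_{1,q}=\frac{(q-1)d+1}{(q-1)d+q}\left[\frac{q-1}{((q-1)d+q)\,2^{\frac{(q-1)d+1}{q-1}}}\left(\frac{q}{q-1}\right)^{\frac{q}{q-1}}\right]^{\frac{q-1}{(q-1)d+1}},\qquad \tilde K_{2,q}=\left(1+2^{\frac{(q-1)d+1}{q-1}}\right)q^{-\frac{q}{q-1}}.$$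
   Context: $\Pi(\mu_1,\mu_2)$ is the set of couplings of $\mu_1,\mu_2$. The Tsallis relative entropy is $D_q(\mu,\nu)=\frac{1}{q-1}\int\big[(\frac{d\mu}{d\nu})^q-\frac{d\mu}{d\nu}\big]\,d\nu$ if $\mu\ll\nu$ and $q>1$, $+\infty$ otherwise. $\mathrm{OT}=\inf_{\pi\in\Pi(\mu_1,\mu_2)}\int c\,d\pi$ and $\mathrm{OT}_{q,\varepsilon}=\inf_{\pi\in\Pi(\mu_1,\mu_2)}\{\int c\,d\pi+\varepsilon D_q(\pi,\mu_1\otimes\mu_2)\}$. *)

(* Defs.v *)
From HB Require Import structures.
From mathcomp Require Import all_boot all_order all_algebra.
From mathcomp Require Import all_classical all_reals all_analysis.
Set Implicit Arguments. Unset Strict Implicit. Unset Printing Implicit Defensive.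
Import Order.TTheory GRing.Theory Num.Theory.
Local Open Scope classical_set_scope.
Local Open Scope ring_scope.

(* R^d is represented by d.-tuple R, with the product (= Borel) sigma-algebra
   provided by mathcomp-analysis (measurable_structure.v). *)

Definition is_uniform_cube (R : realType) (d : nat)
    (mu : probability (d.-tuple R) R) : Prop :=
  forall A : 'I_d -> set R, (forall i, measurable (A i)) ->
    mu [set x : d.-tuple R | forall i, A i (tnth x i)] =
    (\prod_(i < d) (@lebesgue_measure R) (A i `&` `[0%R, 1%R]%classic))%E.

Definition couplings (R : realType) (d1 d2 : measure_display)
    (T1 : measurableType d1) (T2 : measurableType d2)
    (mu1 : probability T1 R) (mu2 : probability T2 R) :
    set (probability (T1 * T2)%type R) :=
  [set P | (forall A, measurable A -> P (A `*` setT) = mu1 A) /\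
           (forall B, measurable B -> P (setT `*` B) = mu2 B)].

Definition is_density (R : realType) (d : measure_display) (T : measurableType d)
    (pi nu : {measure set T -> \bar R}) (f : T -> R) : Prop :=
  measurable_fun setT f /\ (forall x, 0 <= f x) /\
  forall A, measurable A -> pi A = (\int[nu]_(x in A) (f x)%:E)%E.

(* Tsallis relative entropy D_q(pi, nu) = 1/(q-1) int [(dpi/dnu)^q - dpi/dnu] dnu
   when pi << nu (i.e. a density exists), +oo otherwise.  Densities are unique
   nu-a.e., so all densities give the same value; the infimum over the (possibly
   empty) set of densities is that value, and +oo if there is none. *)
Definition tsallis (R : realType) (d : measure_display) (T : measurableType d)
    (q : R) (pi nu : {measure set T -> \bar R}) : \bar R :=
  ereal_inf [set (((q - 1)^-1)%:E * \int[nu]_x ((f x `^ q - f x)%:E))%E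
            | f in is_density pi nu].

Definition l1cost (R : realType) (d : nat) (z : d.-tuple R * d.-tuple R) : R :=
  \sum_(i < d) `|tnth z.1 i - tnth z.2 i|.

Definition OT (R : realType) (d : nat) (mu : probability (d.-tuple R) R) : \bar R :=
  ereal_inf [set (\int[P]_z (l1cost z)%:E)%E | P in couplings mu mu].

Definition OTqe (R : realType) (d : nat) (mu : probability (d.-tuple R) R)
    (q eps : R) : \bar R :=
  ereal_inf [set (\int[P]_z (l1cost z)%:E + eps%:E * tsallis q P (mu \x mu))%E
            | P in couplings mu mu].

Definition K1 (R : realType) (d : nat) (q : R) : R :=
  let a := (q - 1) * d%:R + 1 in
  let b := (q - 1) * d%:R + q in
  a / b * ((q - 1) / (b * 2 `^ (a / (q - 1))) * (q / (q - 1)) `^ (q / (q - 1)))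
          `^ ((q - 1) / a).

Definition K2 (R : realType) (d : nat) (q : R) : R :=
  (1 + 2 `^ (((q - 1) * d%:R + 1) / (q - 1))) * q `^ (- (q / (q - 1))).

(* Main.v *)
(* The diagonal coupling gives OT = 0.  Let B be the strip where |x_i - y_i| < l
   for all i, and let P be a coupling with density f.  Off B the cost is at
   least l, so int c dP >= l (1 - P(B)).  On B, Young's inequality gives
   l f <= eps/(q-1) f^q + M with M = young_const q eps l, and integrating over B
   bounds l P(B) by eps D_q + eps/(q-1) + M (2l)^d, because each section of B
   has measure at most (2l)^d.  The sum is the lower bound
   l - M (2l)^d - eps/(q-1); take l of order eps^(1/((q-1)d+1)). *)
Require Import Defs.
From HB Require Import structures.
From mathcomp Require Import all_boot all_order all_algebra.
From mathcomp Require Import all_classical all_reals all_analysis.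
From mathcomp Require Import measurable_realfun ring lra.
Set Implicit Arguments.
Unset Strict Implicit.
Unset Printing Implicit Defensive.
Import Order.TTheory GRing.Theory Num.Theory numFieldNormedType.Exports.
Local Open Scope classical_set_scope.
Local Open Scope ring_scope.

(** * Young's inequality at the scale of the entropy *)

(* The maximum over x >= 0 of l x - eps/(q-1) x^q. *)
Definition young_const (R : realType) (q eps l : R) : R :=
  (q - 1) / q * (eps * (q / (q - 1))) `^ (- (q - 1)^-1) * l `^ (q / (q - 1)).

(** Young's inequality with conjugate exponents q and q/(q-1), for the factors x h^(1/q) and l
    h^(-1/q). The weight h = eps q/(q-1) turns h x^q/q into the entropy term eps/(q-1) x^q. *)
Lemma young_tsallis (R : realType) (q eps l x : R) :
  1 < q -> 0 < eps -> 0 <= l -> 0 <= x ->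
  l * x <= eps / (q - 1) * x `^ q + young_const q eps l.
Proof.
move=> q1 e0 l0 x0.
have q0 : 0 < q by lra.
have r0 : 0 < q - 1 by lra.
have [h hE] : {h | h = eps * (q / (q - 1))} by exists (eps * (q / (q - 1))).
have h0 : 0 < h by rewrite hE mulr_gt0// divr_gt0.
have hn0 : h != 0 by rewrite gt_eqF.
have := @conjugate_powR R (x * h `^ q^-1) (l * h `^ (- q^-1)) q (q / (q - 1)).
rewrite !mulr_ge0 ?powR_ge0// divr_gt0// => /(_ isT isT q0 isT) Y.
move: Y.
have -> : q^-1 + (q / (q - 1))^-1 = 1 by field; rewrite !gt_eqF.
move=> /(_ erefl).
rewrite !powRM ?powR_ge0// -!powRrM mulVf ?gt_eqF// (powRr1 (ltW h0)).
have -> : - q^-1 * (q / (q - 1)) = - (q - 1)^-1 by field; rewrite !gt_eqF.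
have -> : x * h `^ q^-1 * (l * h `^ (- q^-1)) = l * x.
  by rewrite powRN; field; rewrite gt_eqF// powR_gt0.
move=> /le_trans; apply.
rewrite /young_const -hE.
have -> : x `^ q * h / q = eps / (q - 1) * x `^ q.
  by rewrite hE; field; rewrite !gt_eqF.
rewrite lerD2l le_eqVlt; apply/orP; left; apply/eqP.
by field; rewrite !gt_eqF.
Qed.

Lemma young_const_ge0 (R : realType) (q eps l : R) :
  1 < q -> 0 <= young_const q eps l.
Proof.
by move=> q1; rewrite !mulr_ge0 ?powR_ge0// ?invr_ge0; lra.
Qed.

(** * The entropy controls the mass of small sets *)

Section tsallis_bound.
Context (R : realType) (disp : measure_display) (T : measurableType disp).
Variables (P : probability T R) (nu : {measure set T -> \bar R}).
Local Open Scope ereal_scope.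

(* No integrability of f^q is needed: the negative part of f^q - f is at most
   f, which has integral 1. *)
Lemma density_powR_integral (q : R) (f : T -> R) : is_density P nu f ->
  \int[nu]_x (f x `^ q)%:E = \int[nu]_x (f x `^ q - f x)%:E + 1.
Proof.
move=> [mf [f0 Pf]].
have If : \int[nu]_x (f x)%:E = 1 by rewrite -Pf//; exact: probability_setT.
have mfq : measurable_fun setT (fun x => f x `^ q)%R.
  by apply: (measurableT_comp (@measurable_powR R q)).
pose h x := (f x `^ q - f x)%:E.
have mh : measurable_fun setT h.
  by apply/measurable_EFinP; exact: measurable_funB.
have mhn : measurable_fun setT h^\- by exact: measurable_funeneg.
have mhp : measurable_fun setT h^\+ by exact: measurable_funepos.
have hn1 : \int[nu]_x h^\- x <= 1.
  rewrite -If; apply: ge0_le_integral => //.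
  - exact/measurable_EFinP.
  - move=> x _; rewrite funenegE ge_max /h -EFinN !lee_fin f0 andbT.
    by rewrite opprB lerBlDr lerDl powR_ge0.
have hn0 : 0 <= \int[nu]_x h^\- x by exact: integral_ge0.
have hnfin : \int[nu]_x h^\- x \is a fin_num.
  by rewrite ge0_fin_numE// (le_lt_trans hn1)// ltry.
(* Pointwise both sides are max(f^q, f). Moving the negative part to the left keeps every integrand
   nonnegative, so the integrals add. *)
have E : \int[nu]_x (f x `^ q)%:E + \int[nu]_x h^\- x =
         \int[nu]_x h^\+ x + 1.
  rewrite -If -!ge0_integralD//; last 4 first.
  - by move=> x _; rewrite lee_fin.
  - exact/measurable_EFinP.
  - by move=> x _; rewrite lee_fin powR_ge0.
  - exact/measurable_EFinP.
  apply: eq_integral => x _.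
  rewrite funeposE funenegE /h -EFinN -!EFin_max -!EFinD; congr EFin.
  have [u0|/ltW u0] := @lerP R 0 (f x `^ q - f x).
    by rewrite max_r ?oppr_le0// addr0 subrK.
  by rewrite max_l ?oppr_ge0// opprB subrKC add0r.
rewrite [in RHS]integralE -/h -[LHS](addeK _ hnfin) E.
by rewrite -!addeA [1 + _]addeC.
Qed.

(** Integrate [young_tsallis] at x = f over B; the integral of f^q over B is at most the one over
    the whole space. *)
Lemma tsallis_ge (q eps l b : R) (B : set T) :
  (1 < q)%R -> (0 < eps)%R -> (0 <= l)%R -> measurable B -> nu B <= b%:E ->
  l%:E * P B - (eps / (q - 1) + young_const q eps l * b)%:E
    <= eps%:E * tsallis q P nu.
Proof.
move=> q1 e0 l0 mB nuB.
have q10 : (0 < q - 1)%R by lra.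
(* Dividing by eps leaves a lower bound of an infimum, to be checked density by density; without a
   density the infimum is +oo. *)
rewrite -lee_pdivrMl// /tsallis; apply: le_ereal_inf_tmp => _ [f fd <-].
have fE := density_powR_integral q fd.
have [mf [f0 Pf]] := fd.
have mfq : measurable_fun setT (fun x => f x `^ q)%R.
  by apply: (measurableT_comp (@measurable_powR R q)).
rewrite lee_pdivrMl// muleA -EFinM leeBlDr// EFinD addeA.
have k0 : (0 <= eps / (q - 1))%R by rewrite divr_ge0 ?ltW.
(* The term -f of the entropy integrates to -1, which the constant eps/(q-1) compensates exactly. *)
have -> : (eps / (q - 1))%:E * \int[nu]_x (f x `^ q - f x)%:E
      + (eps / (q - 1))%:E = (eps / (q - 1))%:E * \int[nu]_x (f x `^ q)%:E.
  by rewrite fE [RHS]muleDr ?mule1// fin_num_adde_defl.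
have M0 := young_const_ge0 eps l q1.
apply: (@le_trans _ _ ((eps / (q - 1))%:E * \int[nu]_(x in B) (f x `^ q)%:E
    + (young_const q eps l)%:E * nu B)); last first.
  apply: leeD; last by rewrite [in leRHS]EFinM lee_wpmul2l.
  rewrite lee_wpmul2l//; apply: ge0_subset_integral => //.
  - exact/measurable_EFinP.
  - by move=> x _; rewrite lee_fin powR_ge0.
have mfB : measurable_fun B f by apply: measurable_funTS.
have mfqB : measurable_fun B (fun x => f x `^ q)%R by exact: measurable_funTS.
have ZB (k : R) (g : T -> R) : (0 <= k)%R -> (forall x, 0 <= g x)%R ->
    measurable_fun B g ->
    k%:E * \int[nu]_(x in B) (g x)%:E = \int[nu]_(x in B) (k * g x)%:E.
  move=> kge0 g0 mg; under [RHS]eq_integral do rewrite EFinM.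
  rewrite ge0_integralZl_EFin//; first by move=> x _; rewrite lee_fin.
  exact/measurable_EFinP.
rewrite (Pf _ mB) -(integral_cst nu mB) !ZB//; last by move=> x; exact: powR_ge0.
rewrite -ge0_integralD//; last 2 first.
- by move=> x _; rewrite lee_fin mulr_ge0// powR_ge0.
- by apply/measurable_EFinP; exact: measurable_funM.
apply: ge0_le_integral => //.
- by move=> x _; rewrite lee_fin mulr_ge0.
- by apply/measurable_EFinP; exact: measurable_funM.
- apply: emeasurable_funD => //.
  by apply/measurable_EFinP; exact: measurable_funM.
- by move=> x _; rewrite -EFinD lee_fin young_tsallis.
Qed.

End tsallis_bound.

(** * Comparison of eps/(q-1) with the error term *)

(* With s = 1/(q-1), this reduces to (s+1)^(s+1) <= 2^(s+1) s^s, the convexity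
   of x ln x; it is obtained from ln y >= 1 - 1/y at y = 2/q and y = 2(q-1)/q. *)
Lemma K2_ge (R : realType) (d : nat) (q : R) :
  (0 < d)%N -> 1 < q -> (q - 1)^-1 <= K2 d q.
Proof.
move=> d0 q1; have q10 : 0 < q - 1 by lra.
have q0 : 0 < q by lra.
have d1 : 1 <= d%:R :> R by rewrite ler1n.
pose s := (q - 1)^-1; have s0 : 0 < s by rewrite invr_gt0.
have qs : q / (q - 1) = 1 + s by rewrite /s; field; rewrite gt_eqF.
have ds : ((q - 1) * d%:R + 1) / (q - 1) = d%:R + s.
  by rewrite /s; field; rewrite gt_eqF.
rewrite /K2 qs ds -/s.
have key : s <= 2 `^ (1 + s) * q `^ (- (1 + s)).
  have -> : 2 `^ (1 + s) * q `^ (- (1 + s)) = expR ((1 + s) * (ln 2 - ln q)).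
    by rewrite /powR !gt_eqF// -expRD; congr expR; ring.
  rewrite -[leLHS]lnK ?posrE// ler_expR.
  have lns : ln s = - ln (q - 1) by rewrite lnV.
  have L1 : 1 - q / 2 / (q - 1) <= ln (2 / q) + ln (q - 1).
    rewrite -lnM ?posrE ?divr_gt0//.
    have := @le_ln1Dx R (q / 2 / (q - 1) - 1).
    have y0 : 0 < q / 2 / (q - 1) by rewrite !divr_gt0.
    rewrite ltrBrDr addNr y0 => /(_ isT).
    have -> : 1 + (q / 2 / (q - 1) - 1) = (2 / q * (q - 1))^-1.
      by field; rewrite !gt_eqF.
    rewrite lnV ?posrE ?mulr_gt0 ?invr_gt0//; lra.
  have L2 : 1 - q / 2 <= ln (2 / q).
    have := @le_ln1Dx R (q / 2 - 1).
    rewrite ltrBrDr addNr divr_gt0// => /(_ isT).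
    have -> : 1 + (q / 2 - 1) = (2 / q)^-1 by field; rewrite gt_eqF.
    rewrite lnV ?posrE ?divr_gt0//; lra.
  have -> : (1 + s) = q / (q - 1) by rewrite qs.
  rewrite lns -ln_div ?posrE// mulrAC ler_pdivlMr//.
  (* Weighting [L1] by q-1 and [L2] by 1, the lower bounds add up to 0 and the logarithms to q
     ln(2/q) + (q-1) ln(q-1). *)
  have : (1 - q / 2 / (q - 1)) * (q - 1) <= (ln (2 / q) + ln (q - 1)) * (q - 1).
    by rewrite ler_pM2r.
  have -> : (1 - q / 2 / (q - 1)) * (q - 1) = q - 1 - q / 2.
    by field; rewrite gt_eqF.
  lra.
(* Since d >= 1, the factor 1 + 2^(d+s) dominates 2^(1+s). *)
apply: (le_trans key); apply: ler_wpM2r; first exact: powR_ge0.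
apply: (@le_trans _ _ (2 `^ (d%:R + s))); last by rewrite lerDr.
by apply: ler_powR; lra.
Qed.

(** * The strip around the diagonal *)

Lemma cube_ball_le (R : realType) (d : nat) (mu : probability (d.-tuple R) R)
    (l : R) (y : d.-tuple R) : is_uniform_cube mu -> 0 <= l ->
  (mu [set x | forall i, ball (tnth y i) l (tnth x i)] <= ((2 * l) ^+ d)%:E)%E.
Proof.
move=> mu_unif l0.
rewrite (mu_unif (fun i => ball (tnth y i) l)); last first.
  by move=> i; exact: measurable_ball.
rewrite -[X in (_ ^+ X)%R]card_ord -prodr_const -prodEFin.
(* Inequalities multiply only between nonnegative factors, so the induction carries nonnegativity
   along. *)
suff : (0 <= \prod_(i < d) lebesgue_measure (ball (tnth y i) l `&` `[0%R, 1%R])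
    <= \prod_(i < d) (2 * l)%:E)%E by move=> /andP[].
elim/big_ind2 : _ => [|x1 x2 y1 y2 /andP[x0 x12] /andP[y0 y12]|i _].
- by rewrite lexx lee01.
- by rewrite mule_ge0//= lee_pmul.
- rewrite measure_ge0/= mulr_natl -(lebesgue_measure_ball (tnth y i) l0).
  apply: le_measure; rewrite ?inE//; last exact: measurable_ball.
  by apply: measurableI => //; exact: measurable_ball.
Qed.

(** Written with [ball] so that its section at a point is the set bounded in [cube_ball_le]. *)
Definition strip (R : realType) (d : nat) (l : R) :
    set (d.-tuple R * d.-tuple R)%type :=
  [set z | forall i, ball (tnth z.1 i) l (tnth z.2 i)].
Arguments strip {R} d l.

Lemma measurable_coord_dist (R : realType) (d : nat) (i : 'I_d) :
  measurable_fun setT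
    (fun z : d.-tuple R * d.-tuple R => `|tnth z.1 i - tnth z.2 i|).
Proof.
apply: measurableT_comp => //; apply: measurable_funB.
  exact: (measurableT_comp (measurable_tnth i)).
exact: (measurableT_comp (measurable_tnth i)).
Qed.

Lemma measurable_l1cost (R : realType) (d : nat) :
  measurable_fun setT (@l1cost R d).
Proof. by apply: measurable_sum => i; exact: measurable_coord_dist. Qed.

Lemma measurable_strip (R : realType) (d : nat) (l : R) :
  measurable (strip d l).
Proof.
have -> : strip d l = \bigcap_(i in [set: 'I_d])
    ((fun z => `|tnth z.1 i - tnth z.2 i|) @^-1` [set r | r < l]).
  by apply/seteqP; split=> z /= h i; [move=> _|]; apply: h.
apply: fin_bigcap_measurable => // i _; rewrite -[X in measurable X]setTI.
apply: measurable_coord_dist => //.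
by apply: open_measurable; exact: open_lt.
Qed.
Arguments measurable_strip {R} d l.

Lemma strip_le (R : realType) (d : nat) (mu : probability (d.-tuple R) R)
    (l : R) : is_uniform_cube mu -> 0 <= l ->
  ((mu \x mu) (strip d l) <= ((2 * l) ^+ d)%:E)%E.
Proof.
move=> mu_unif l0; rewrite /product_measure1/=.
apply: (@le_trans _ _ (\int[mu]_x (cst ((2 * l) ^+ d)%:E x))%E).
  apply: ge0_le_integral => //.
  - exact: (measurable_fun_xsection mu (measurable_strip d l)).
  - move=> x _ /=; rewrite xsectionE.
    exact: cube_ball_le.
by rewrite -[leRHS]mule1 -(probability_setT mu) integral_cst.
Qed.

(** * The transport cost off the strip and on the diagonal *)

Lemma l1cost_ge (R : realType) (d : nat) (l : R) (z : d.-tuple R * d.-tuple R) :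
  ~ strip d l z -> l <= l1cost z.
Proof.
move=> /existsNP[i]; rewrite /ball/= => /negP; rewrite -leNgt => li.
by rewrite /l1cost (bigD1 i)//= (le_trans li)// lerDl sumr_ge0.
Qed.

Lemma l1cost_ge0 (R : realType) (d : nat) (z : d.-tuple R * d.-tuple R) :
  0 <= l1cost z.
Proof. by rewrite sumr_ge0. Qed.

(** Markov's inequality on the complement of the strip, where the cost is at least l. *)
Lemma integral_l1cost_ge (R : realType) (d : nat)
    (P : probability (d.-tuple R * d.-tuple R)%type R) (l : R) : 0 <= l ->
  (l%:E - l%:E * P (strip d l) <= \int[P]_z (l1cost z)%:E)%E.
Proof.
move=> l0; have mB := measurable_strip d l.
have -> : (l%:E - l%:E * P (strip d l) = l%:E * P (~` strip d l))%E.
  rewrite probability_setC// -(fineK (fin_num_measure P _ mB)).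
  by rewrite -EFinB -!EFinM mulrBr mulr1.
rewrite -integral_cst//; last exact: measurableC.
apply: (@le_trans _ _ (\int[P]_(z in ~` strip d l) (l1cost z)%:E)%E).
  apply: ge0_le_integral => //; first exact: measurableC.
  - by apply/measurable_EFinP; apply: measurable_funTS; exact: measurable_l1cost.
  - by move=> z; rewrite lee_fin; exact: l1cost_ge.
apply: ge0_subset_integral => //; first exact: measurableC.
- by apply/measurable_EFinP; exact: measurable_l1cost.
- by move=> z _; rewrite lee_fin l1cost_ge0.
Qed.

(** The image of [mu] under x -> (x, x) is a coupling of zero cost. *)
Lemma OT_self (R : realType) (d : nat) (mu : probability (d.-tuple R) R) :
  OT mu = 0%E.
Proof.
apply/eqP; rewrite eq_le; apply/andP; split; last first.
  apply: le_ereal_inf_tmp => _ [P _ <-]; apply: integral_ge0 => z _.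
  by rewrite lee_fin l1cost_ge0.
pose diag (x : d.-tuple R) := (x, x).
have mdiag : measurable_fun setT diag by exact: measurable_fun_pair.
apply: ereal_inf_lbound.
pose diagm : {mfun _ >-> _} := mfun_Sub (mem_set mdiag).
exists (distribution mu diagm).
  by split=> A mA; rewrite /distribution /pushforward/=; congr (mu _);
    apply/seteqP; split=> x /= => [[]|].
rewrite ge0_integral_distribution//.
  apply: integral0_eq => x _ /=; rewrite /l1cost big1// => i _.
  by rewrite subrr normr0.
- by apply/measurable_EFinP; exact: measurable_l1cost.
- by move=> y; rewrite lee_fin l1cost_ge0.
Qed.

(** * Choice of the strip width *)

(* The maximizer of l - young_const q eps l * (2l)^d, except that 2^d is
   replaced by 2^(d+1/(q-1)) so as to produce K1 exactly. *)
Definition radius (R : realType) (d : nat) (q eps : R) : R :=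
  let a := (q - 1) * d%:R + 1 in
  let b := (q - 1) * d%:R + q in
  ((q - 1) / (b * 2 `^ (a / (q - 1))) * (q / (q - 1)) `^ (q / (q - 1)))
    `^ ((q - 1) / a) * eps `^ a^-1.

(** With s = 1/(q-1), the left side times 2^s equals the right side, and 2^s >= 1; this surplus
    comes from the power 2^(d+s) in [radius]. *)
Lemma radius_balance (R : realType) (d : nat) (q eps : R) :
  1 < q -> 0 < eps ->
  young_const q eps (radius d q eps) * (2 * radius d q eps) ^+ d
    <= (q - 1) / ((q - 1) * d%:R + q) * radius d q eps.
Proof.
move=> q1 e0; have r0 : 0 < q - 1 by lra.
have q0 : 0 < q by lra.
have d0 : 0 <= d%:R :> R by [].
set a := (q - 1) * d%:R + 1; set b := (q - 1) * d%:R + q.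
have a0 : 0 < a by rewrite ltr_wpDl// mulr_ge0// ltW.
have b0 : 0 < b by rewrite ltr_wpDl// mulr_ge0// ltW.
pose s := (q - 1)^-1; have s0 : 0 < s by rewrite invr_gt0.
have qs : q / (q - 1) = 1 + s by rewrite /s; field; rewrite gt_eqF.
have ads : a / (q - 1) = d%:R + s by rewrite /a /s; field; rewrite gt_eqF.
have [p pE] : {p | p = q / (q - 1)} by exists (q / (q - 1)).
have p0 : 0 < p by rewrite pE divr_gt0.
have pow_p x : x `^ p = x `^ (1 + s) by rewrite pE qs.
have [br brE] : {br | br = (q - 1) / (b * 2 `^ (d%:R + s)) * p `^ (1 + s)}.
  by exists ((q - 1) / (b * 2 `^ (d%:R + s)) * p `^ (1 + s)).
have br0 : 0 < br by rewrite brE mulr_gt0 ?divr_gt0 ?mulr_gt0 ?powR_gt0.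
have : radius d q eps = br `^ ((q - 1) / a) * eps `^ a^-1.
  by rewrite /radius -/a -/b ads -pE (pow_p p) -brE.
move: (radius d q eps) => l lE.
have l0 : 0 < l by rewrite lE mulr_gt0 ?powR_gt0.
(* The exponents in [radius] are (q-1)/a = 1/(d+s) and 1/a = s/(d+s). *)
have lds : l `^ (d%:R + s) = br * eps `^ s.
  rewrite lE (powRM _ (powR_ge0 _ _) (powR_ge0 _ _)) -!powRrM.
  have -> : (q - 1) / a * (d%:R + s) = 1 by rewrite -ads; field; rewrite !gt_eqF.
  have -> : a^-1 * (d%:R + s) = s by rewrite -ads /s; field; rewrite !gt_eqF.
  by rewrite (powRr1 (ltW br0)).
have pw x (u v : R) : 0 < x -> x `^ (u + v) = x `^ u * x `^ v.
  by move=> x0; rewrite powRD// (gt_eqF x0) implybT.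
have E : young_const q eps l * (2 * l) ^+ d * 2 `^ s = (q - 1) / b * l.
  rewrite /young_const -pE -/s (pow_p l).
  have -> : (q - 1) / q = p^-1 by rewrite pE invf_div.
  rewrite (powRM _ (ltW e0) (ltW p0)) !powRN -powR_mulrn ?mulr_ge0 ?ltW//.
  rewrite (powRM _ _ (ltW l0))// (pw l)// (powRr1 (ltW l0)).
  have es : eps `^ s != 0 by rewrite gt_eqF// powR_gt0.
  have ps : p `^ s != 0 by rewrite gt_eqF// powR_gt0.
  have t1 : 2 `^ s != 0 :> R by rewrite gt_eqF// powR_gt0.
  have t2 : 2 `^ d%:R != 0 :> R by rewrite gt_eqF// powR_gt0.
  move: lds; rewrite (pw l)// brE (pw 2)// (pw p)// (powRr1 (ltW p0)) => lds.
  (* One factor l of l^(1+s) l^d is set aside; the remaining l^(d+s) is replaced through [lds]. *)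
  transitivity (p^-1 / (eps `^ s * p `^ s) * l * (2 `^ d%:R * 2 `^ s)
    * (l `^ d%:R * l `^ s)); first by field; rewrite es ps (gt_eqF p0).
  rewrite lds; field.
  by rewrite es ps t1 t2 !gt_eqF.
rewrite -E ler_peMr//.
  by rewrite mulr_ge0 ?young_const_ge0// exprn_ge0// mulr_ge0// ltW.
have : 2 `^ 0 <= 2 `^ s :> R by apply: ler_powR; lra.
by rewrite powRr0.
Qed.

Theorem theorem1p3 (R : realType) (d : nat) (mu : probability (d.-tuple R) R)
    (q eps : R) :
  (0 < d)%N -> is_uniform_cube mu -> 1 < q -> 0 < eps ->
  ((K1 d q * eps `^ (((q - 1) * d%:R + 1)^-1) - K2 d q * eps)%:E
     <= OTqe mu q eps - OT mu)%E.
Proof.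
move=> d0 mu_unif q1 e0; rewrite OT_self sube0.
set l := radius d q eps.
have l0 : 0 <= l by rewrite mulr_ge0 ?powR_ge0.
have K2e : eps / (q - 1) <= K2 d q * eps.
  by rewrite mulrC ler_pM2r ?K2_ge.
apply: le_ereal_inf_tmp => _ [P _ <-].
have mB := measurable_strip d l.
(* The terms l P(strip) of the two bounds are finite and cancel in the sum. *)
apply: le_trans (leeD (integral_l1cost_ge P l0)
  (tsallis_ge P q1 e0 l0 mB (strip_le mu_unif l0))).
rewrite -(fineK (fin_num_measure P _ mB)) -!EFinM -!EFinB -EFinD lee_fin.
have := radius_balance d q1 e0; rewrite -/l => bal.
(* By the choice of [radius] the left side is (a/b) l, and a/b = 1 - (q-1)/b because b - a = q-1. *)
have KE : K1 d q * eps `^ (((q - 1) * d%:R + 1)^-1) =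
    l - (q - 1) / ((q - 1) * d%:R + q) * l.
  rewrite /K1 -mulrA -[X in _ * X = _]/l.
  have b0 : (q - 1) * d%:R + q != 0.
    by rewrite gt_eqF// ltr_wpDl ?mulr_ge0//; lra.
  by move: (l) => r; field.
rewrite KE; lra.
Qed.
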